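(* Let $S$ be a right LCM monoid and let $N\colon S\to\mathbb{N}^\times$, $s\mapsto N_s$, be a nontrivial homomorphism. Then $N$ satisfies (a) $|N^{-1}(n)/_\sim|=n$ for all $n\in N(S)$, and (b) for each $n\in N(S)$, every transversal for $N^{-1}(n)/_\sim$ is an accurate foundation set for $S$, if and only if $N$ satisfies (i) $|N^{-1}(n)/_\sim|=n$ for all $n\in N(S)$, (ii) $N_s=N_t$ implies $s\sim t$ or $s\perp t$, and (iii) for all $s\in S$ and $n\in N(S)$ there exists $t\in N^{-1}(n)$ with $s\Cap t$.
   Context: $\mathbb{N}^\times$ denotes the multiplicative monoid of positive integers; a homomorphism to it is nontrivial if it is not identically $1$. A right LCM monoid is a left cancellative monoid $S$ (with unit) in which the intersection $sS\cap tS$ of any two principal right ideals is either empty or again a principal right ideal. For $s,t\in S$ write $s\Cap t$ if $sS\cap tS\neq\emptyset$, and $s\perp t$ otherwise. The core of $S$ is $S_c:=\{a\in S\mid a\Cap s\text{ for all }s\in S\}$. Elements $s,t\in S$ are core equivalent, $s\sim t$, if there are $a,b\in S_c$ with $sa=tb$; this is an equivalence relation. A foundation set is a finite subset $F\subset S$ such that for every $s\in S$ there is $t\in F$ with $s\Cap t$; it is accurate if $s\perp t$ for all $s,t\in F$ with $s\neq t$. A transversal for $N^{-1}(n)/_\sim$ is a subset of $N^{-1}(n)$ containing exactly one representative of each class. *)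

(* Defs.v *)
From HB Require Import structures.
From mathcomp Require Import all_boot.
From mathcomp Require Import monoid.
From mathcomp Require Import boolp classical_sets functions cardinality.

Set Implicit Arguments.
Unset Strict Implicit.
Unset Printing Implicit Defensive.

Local Open Scope classical_set_scope.
Local Open Scope card_scope.
Local Open Scope group_scope.

Section RightLCM.
Context {S : monoidType}.
Implicit Types (s t a b : S) (A F T : set S).

Definition rideal s : set S := [set s * x | x in [set: S]].

Definition left_cancellative : Prop := forall s, injective (fun x : S => s * x).

Definition right_LCM : Prop :=
  left_cancellative /\
  forall s t, rideal s `&` rideal t = set0 \/
    exists r, rideal s `&` rideal t = rideal r.

Definition rmeet s t : Prop := rideal s `&` rideal t !=set0.

Definition rperp s t : Prop := ~ rmeet s t.

Definition core : set S := [set a | forall s, rmeet a s].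

Definition core_equiv s t : Prop :=
  exists a b, [/\ core a, core b & s * a = t * b].

Definition foundation_set F : Prop :=
  finite_set F /\ forall s, exists2 t, F t & rmeet s t.

Definition accurate F : Prop :=
  forall s t, F s -> F t -> s <> t -> rperp s t.

(* Classes are taken inside [A]: the quotient of [A] by the restriction of core
   equivalence to [A]. *)
Definition core_quotient A : set (set S) :=
  [set A `&` [set t | core_equiv s t] | s in A].

Definition core_transversal A T : Prop :=
  T `<=` A /\ forall C, core_quotient A C -> exists! t, (T `&` C) t.

Definition is_hom_posnat (N : S -> nat) : Prop :=
  [/\ forall s, (0 < N s)%N, N 1 = 1%N & forall s t, N (s * t) = (N s * N t)%N].

Definition nontrivial_hom (N : S -> nat) : Prop := ~ (forall s, N s = 1%N).

Definition fiber (N : S -> nat) (n : nat) : set S := [set s | N s = n].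

End RightLCM.

Arguments left_cancellative S : clear implicits.
Arguments right_LCM S : clear implicits.

(* Main.v *)
Require Import Defs.
From mathcomp Require Import all_boot monoid.
From mathcomp Require Import boolp classical_sets functions cardinality.

Local Open Scope classical_set_scope.
Local Open Scope card_scope.

(** Core equivalent elements meet the same elements, so a transversal of a fiber
  meets whatever the fiber meets: this matches foundation sets with (iii).
  Any two inequivalent elements of a fiber extend to a transversal, so
  accuracy of all transversals amounts to (ii). *)

Section CoreEquivalence.
Set Implicit Arguments.
Unset Strict Implicit.
Unset Printing Implicit Defensive.
Local Open Scope group_scope.
Context {S : monoidType}.
Implicit Types (s t r a b : S) (A B C T : set S).

Lemma rmeetP s t : rmeet s t <-> exists x y, s * x = t * y.
Proof.
split=> [[z [[x _ <-] [y _ tyE]]]|[x [y sxE]]]; first by exists x, y.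
by exists (s * x); split; [exists x | exists y].
Qed.

Lemma core1 : core (1 : S).
Proof. by move=> s; apply/rmeetP; exists s, 1; rewrite mul1g mulg1. Qed.

Lemma coreM a b : core a -> core b -> core (a * b).
Proof.
move=> ca cb s; have /rmeetP[x [y axE]] := ca s.
have /rmeetP[z [w bzE]] := cb x.
by apply/rmeetP; exists z, (y * w); rewrite -mulgA bzE !mulgA axE.
Qed.

Lemma core_equiv_refl s : core_equiv s s.
Proof. by exists 1, 1; split=> //; exact: core1. Qed.

Lemma core_equiv_sym s t : core_equiv s t -> core_equiv t s.
Proof. by move=> [a [b [ca cb saE]]]; exists b, a. Qed.

(** Apply coreness of [a * b] to [a * s] and cancel [a] on the left. *)
Lemma core_mulr a b : left_cancellative S -> core (a * b) -> core b.
Proof.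
move=> hS cab s; have /rmeetP[x [y abxE]] := cab (a * s).
by apply/rmeetP; exists x, y; apply: (hS a); rewrite /= !mulgA.
Qed.

(** The Ore condition inside the core, needed for transitivity of core equivalence. A generator [r]
    of the intersection of the two ideals is itself core, and [core_mulr] passes this on to the
    cofactors [x] and [y]. *)
Lemma core_common_multiple a b : right_LCM S -> core a -> core b ->
  exists x y, [/\ core x, core y & a * x = b * y].
Proof.
move=> [hS lcmS] ca cb; case: (lcmS a b) => [ab0|[r abE]].
  by have := ca b; rewrite /rmeet ab0 => -[].
have [[x _ axE] [y _ byE]] : (rideal a `&` rideal b) r.
  by rewrite abE; exists 1; rewrite ?mulg1.
have cr : core r.
  (* First [a] is made to meet [s], then [b] to meet [a * z]; the resulting element lies in both
     ideals, hence in [rideal r], and is still a right multiple of [s]. *)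
  move=> s; have /rmeetP[z [w azE]] := ca s.
  have /rmeetP[u [v buE]] := cb (a * z).
  have [m _ rmE] : rideal r (a * z * v).
    by rewrite -abE; split; [exists (z * v); rewrite ?mulgA | exists u].
  by apply/rmeetP; exists m, (w * v); rewrite rmE azE mulgA.
exists x, y; split; last by rewrite axE byE.
- by apply: (@core_mulr a) => //; rewrite axE.
- by apply: (@core_mulr b) => //; rewrite byE.
Qed.

Lemma core_equiv_trans s t r : right_LCM S ->
  core_equiv s t -> core_equiv t r -> core_equiv s r.
Proof.
move=> hS [a [b [ca cb saE]]] [c [d [cc cd tcE]]].
have [x [y [cx cy bxE]]] := core_common_multiple hS cb cc.
exists (a * x), (d * y); split; [exact: coreM|exact: coreM|].
by rewrite !mulgA saE -tcE -!mulgA bxE.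
Qed.

(** A common multiple [t * q] can be extended to one of [t * a], since the core element [a] meets
    [q]; and [t * a] is a right multiple of [r]. *)
Lemma rmeet_core_equiv s t r : rmeet s t -> core_equiv t r -> rmeet s r.
Proof.
move=> /rmeetP[p [q spE]] [a [b [ca _ taE]]].
have /rmeetP[x [y axE]] := ca q.
by apply/rmeetP; exists (p * y), (b * x); rewrite !mulgA spE -taE -!mulgA axE.
Qed.

Lemma core_quotient_mem A s : A s ->
  core_quotient A (A `&` [set t | core_equiv s t]).
Proof. by move=> As; exists s. Qed.

Lemma core_quotient_eq A C C' s : right_LCM S ->
  core_quotient A C -> core_quotient A C' -> C s -> C' s -> C = C'.
Proof.
move=> hS [t At <-] [t' At' <-] [_ ts] [_ t's].
apply/seteqP; split=> x [Ax ex]; split=> //=.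
- exact: core_equiv_trans hS (core_equiv_trans hS t's (core_equiv_sym ts)) ex.
- exact: core_equiv_trans hS (core_equiv_trans hS ts (core_equiv_sym t's)) ex.
Qed.

(** A choice of one representative per class that prefers elements of [B]. Empty [B] gives existence
    of transversals, a pair [B] gives one through two prescribed inequivalent elements. *)
Lemma core_transversal_extend A B : right_LCM S -> B `<=` A ->
  (forall s t, B s -> B t -> core_equiv s t -> s = t) ->
  exists2 T, core_transversal A T & B `<=` T.
Proof.
move=> hS BA Binj.
have [f fP] : {f : set S -> S & forall C, core_quotient A C ->
    C (f C) /\ (C `&` B !=set0 -> B (f C))}.
  apply: (@choice _ _ (fun C s => core_quotient A C ->
    C s /\ (C `&` B !=set0 -> B s))) => C.
  (* Pick a point of [B] if [C] has one, otherwise any point of the class; [1] is a dummy value for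
     sets that are not classes. *)
  have [[s [Cs Bs]]|CB0] := pselect (C `&` B !=set0); first by exists s.
  have [[s As CE]|nC] := pselect (core_quotient A C); last by exists 1.
  exists s => _; split=> [|/CB0[]].
  by rewrite -CE; split=> //; exact: core_equiv_refl.
exists (f @` core_quotient A).
  split=> [_ [C qC <-]|C qC].
    by have [CfC _] := fP C qC; case: qC CfC => s _ <- [].
  have [CfC _] := fP C qC.
  exists (f C); split=> [|_ [[C' qC' <-] CfC']]; first by split=> //; exists C.
  by have [C'fC' _] := fP C' qC'; rewrite (core_quotient_eq hS qC qC' CfC').
move=> s Bs; have qC := core_quotient_mem (BA s Bs).
have Cs : (A `&` [set t | core_equiv s t]) s.
  by split; [exact: BA | exact: core_equiv_refl].
(* The class of [s] meets [B], so its chosen point is in [B] and equivalent to [s], hence equal to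
   [s]. *)
have [[_ sf] Bf] := fP _ qC.
exists (A `&` [set t | core_equiv s t]) => //; apply/esym/Binj => //.
by apply: Bf; exists s.
Qed.

Lemma core_transversal_rep A T s : core_transversal A T -> A s ->
  exists2 t, T t & core_equiv s t.
Proof.
move=> [_ TP] /core_quotient_mem/TP[t [[Tt [_ st]] _]].
by exists t.
Qed.

Lemma core_transversal_inj A T s t : core_transversal A T ->
  T s -> T t -> core_equiv s t -> s = t.
Proof.
move=> [TA TP] Ts Tt st.
have [u [_ uP]] := TP _ (core_quotient_mem (TA s Ts)).
rewrite -(uP s); last by split=> //; split; [exact: TA|exact: core_equiv_refl].
by apply: uP; split=> //; split=> //; exact: TA.
Qed.

(** [T] is covered by the image of the quotient under the map taking a class to its representative
    in [T]; the default [1] of [xget] is never reached on a class. *)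
Lemma core_transversal_finite A T : core_transversal A T ->
  finite_set (core_quotient A) -> finite_set T.
Proof.
move=> TP /(finite_image (fun C => xget 1 (T `&` C))); apply: sub_finite_set.
move=> s Ts; have As := TP.1 s Ts.
exists (A `&` [set t | core_equiv s t]); first exact: core_quotient_mem.
apply: xget_unique => [|t [Tt [_ st]]].
  by split=> //; split=> //; exact: core_equiv_refl.
exact/esym/(core_transversal_inj TP).
Qed.

End CoreEquivalence.

Theorem proposition2p5 (S : monoidType) (N : S -> nat)
    (hS : right_LCM S) (hN : is_hom_posnat N) (hN1 : nontrivial_hom N) :
  ((forall n, range N n -> core_quotient (fiber N n) #= `I_n) /\
   (forall n, range N n -> forall T : set S, core_transversal (fiber N n) T ->
      foundation_set T /\ accurate T))
  <->
  [/\ forall n, range N n -> core_quotient (fiber N n) #= `I_n,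
      forall s t : S, N s = N t -> core_equiv s t \/ rperp s t
    & forall (s : S) n, range N n -> exists2 t, fiber N n t & rmeet s t].
Proof.
split=> [[cardN accN]|[cardN perpN meetN]].
  split=> // [s t Nst|s n Nn].
    have [|nst] := pselect (core_equiv s t); [by left|right].
    have sub : [set s; t] `<=` fiber N (N s) by move=> _ [->|->].
    have inj u v : [set s; t] u -> [set s; t] v -> core_equiv u v -> u = v.
      by move=> [->|->] [->|->] // /core_equiv_sym.
    have [T TP stT] := core_transversal_extend hS sub inj.
    have [_ accT] := accN (N s) (imageT N s) T TP.
    have [Ts Tt] : T s /\ T t by split; apply: stT; [left|right].
    (* Accuracy only concerns distinct elements; [s] and [t] are distinct because they are
       inequivalent. *)
    apply: (accT s t Ts Tt) => st.
    by apply: nst; rewrite st; exact: core_equiv_refl.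
  have [T TP _] : exists2 T, core_transversal (fiber N n) T & set0 `<=` T.
    exact: core_transversal_extend.
  have [[_ /(_ s)[t Tt st]] _] := accN n Nn T TP.
  by exists t => //; exact: TP.1.
split=> // n Nn T TP; split; first split.
- by apply: (core_transversal_finite TP); exists n; exact: cardN.
- move=> s; have [t Nt st] := meetN s n Nn.
  have [r Tr tr] := core_transversal_rep TP Nt.
  by exists r => //; exact: rmeet_core_equiv st tr.
- move=> s t Ts Tt st.
  (* Distinct elements of a transversal are inequivalent, so (ii) leaves only orthogonality. *)
  have Nst : N s = N t by rewrite [LHS](TP.1 s Ts) [RHS](TP.1 t Tt).
  by have [/(core_transversal_inj TP Ts Tt)|] := perpN s t Nst.
Qed.
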